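(* Let $\mathcal Y_3\subset\mathbb R^2$ be three non-collinear points and let $X_1,X_2,\ldots,X_n\stackrel{iid}{\sim}\mathcal U(T(\mathcal Y_3))$. For sufficiently small $r\ge1$ (i.e., there is $r_0>1$ such that this holds for all $r\in[1,r_0)$), $$\rho^{\text{and}}_n(r)<^{ST}\rho_n(r)<^{ST}\rho^{\text{or}}_n(r)\quad\text{as } n\to\infty$$ (i.e., for all sufficiently large $n$), where $\rho_n(r)$ is the relative arc density of the proportional-edge proximity catch digraph $D_n(r)$, and $\rho^{\text{and}}_n(r)$, $\rho^{\text{or}}_n(r)$ are the relative edge densities of its reflexivity and underlying graphs.
   Context: $U<^{ST}V$ denotes the (strict) stochastic order: $P(U\le t)\ge P(V\le t)$ for all $t\in\mathbb R$, with strict inequality for some $t$. $T(\mathcal Y_3)$ is the closed triangle with vertices $\mathcal Y_3=\{y_1,y_2,y_3\}$ and $\mathcal U(T(\mathcal Y_3))$ the uniform distribution on it. The vertex regions $R(y_1),R(y_2),R(y_3)$ (with $y_i\in R(y_i)$) partition $T(\mathcal Y_3)$ using the segments from its center of mass to its edge midpoints. For $x\in T(\mathcal Y_3)\setminus\mathcal Y_3$, let $v(x)$ be the vertex whose region contains $x$ (chosen arbitrarily on boundaries of regions), $e(x)$ the edge opposite $v(x)$, and $\ell(v(x),x)$ the line through $x$ parallel to $e(x)$; $d$ is Euclidean distance. For $r\in[1,\infty)$ let $\ell_r(v(x),x)$ be the line parallel to $e(x)$ with $d(v(x),\ell_r(v(x),x))=r\,d(v(x),\ell(v(x),x))$ and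 $d(\ell(v(x),x),\ell_r(v(x),x))<d(v(x),\ell_r(v(x),x))$, and let $T_r(x)$ be the triangle similar to and with the same orientation as $T(\mathcal Y_3)$ having $v(x)$ as a vertex and its opposite edge on $\ell_r(v(x),x)$. The proportional-edge proximity region is $N^r_{PE}(x)=T_r(x)\cap T(\mathcal Y_3)$, with $N^r_{PE}(x)=\{x\}$ for $x\in\mathcal Y_3$. The proportional-edge PCD $D_n(r)$ has vertices $X_1,\ldots,X_n$ and an arc $(X_i,X_j)$, $i\ne j$, iff $X_j\in N^r_{PE}(X_i)$; its relative arc density is $\rho_n(r)=$ (number of arcs)$/(n(n-1))$. The reflexivity (underlying) graph has edge $X_iX_j$ iff both (at least one) of $(X_i,X_j),(X_j,X_i)$ are arcs (is an arc); relative edge density is (number of edges)$/\binom n2$. *)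

(* Defs.v *)
From HB Require Import structures.
From mathcomp Require Import all_boot all_order all_algebra.
From mathcomp Require Import all_classical all_reals all_analysis.

Set Implicit Arguments.
Unset Strict Implicit.
Unset Printing Implicit Defensive.

Import Order.TTheory GRing.Theory Num.Theory.
Local Open Scope classical_set_scope.
Local Open Scope ring_scope.

(* Points of the plane are elements of R * R. The norm that the library puts on
   R * R is the sup norm, whence the explicit Euclidean distance. *)
Section PlaneGeometry.
Context {R : realType}.
Local Notation plane := (R * R)%type.

Definition dist (p q : plane) : R :=
  Num.sqrt ((p.1 - q.1) ^+ 2 + (p.2 - q.2) ^+ 2).

Definition dist_pt_set (p : plane) (L : set plane) : R :=
  inf [set dist p q | q in L].

Definition dist_set_set (L M : set plane) : R :=
  inf [set dist p q | p in L & q in M].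

Definition line_dir (p u : plane) : set plane := [set p + t *: u | t in setT].

Definition collinear3 (y : 'I_3 -> plane) : Prop :=
  exists p u : plane, u != 0 /\ forall i, line_dir p u (y i).

Definition hull (s : seq plane) : set plane :=
  [set p | exists w : 'I_(size s) -> R,
     [/\ forall k, 0 <= w k, \sum_k w k = 1 & p = \sum_k w k *: s`_k]].

Definition triangle (y : 'I_3 -> plane) : set plane :=
  hull [:: y 0; y 1; y 2%:R].

(* Indices in 'I_3 are added modulo 3, so that y (i + 1) and y (i + 2%:R) are
   the two vertices other than y i. *)
Definition opp_edge (y : 'I_3 -> plane) (i : 'I_3) : set plane :=
  hull [:: y (i + 1); y (i + 2%:R)].

Definition parallel_edge (y : 'I_3 -> plane) (i : 'I_3) (p : plane) : set plane :=
  line_dir p (y (i + 2%:R) - y (i + 1)).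

Definition midpoint (p q : plane) : plane := 2^-1 *: (p + q).

Definition centroid (y : 'I_3 -> plane) : plane := 3^-1 *: \sum_i y i.

(* The closed quadrilateral cut off at y i by the two segments from the center
   of mass to the midpoints of the edges adjacent to y i; it is convex. *)
Definition vertex_region (y : 'I_3 -> plane) (i : 'I_3) : set plane :=
  hull [:: y i; midpoint (y i) (y (i + 1)); centroid y;
           midpoint (y i) (y (i + 2%:R))].

(* A map x |-> v(x), with arbitrary choices on the common boundaries. *)
Definition vertex_choice (y : 'I_3 -> plane) (v : plane -> 'I_3) : Prop :=
  forall x, triangle y x -> ~ range y x -> vertex_region y (v x) x.

(* L is the line l_r(y i, x), with l(y i, x) = parallel_edge y i x. *)
Definition is_ell_r (y : 'I_3 -> plane) (r : R) (i : 'I_3) (x : plane)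
    (L : set plane) : Prop :=
  [/\ exists p, L = parallel_edge y i p,
      dist_pt_set (y i) L = r * dist_pt_set (y i) (parallel_edge y i x)
    & dist_set_set (parallel_edge y i x) L < dist_pt_set (y i) L].

Definition similar (y z : 'I_3 -> plane) : Prop :=
  exists2 k : R, 0 < k & forall i j, dist (z i) (z j) = k * dist (y i) (y j).

(* Twice the signed area. *)
Definition signed_area2 (y : 'I_3 -> plane) : R :=
  ((y 1).1 - (y 0).1) * ((y 2%:R).2 - (y 0).2)
  - ((y 1).2 - (y 0).2) * ((y 2%:R).1 - (y 0).1).

Definition same_orientation (y z : 'I_3 -> plane) : Prop :=
  Num.sg (signed_area2 z) = Num.sg (signed_area2 y).

(* The triangle T_r(x) for v(x) = y i. The similarity sends y j to z j; it fixes
   y i and sends the opposite edge to an edge parallel to it, so the sides of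
   z are parallel to those of y, and z is unique. *)
Definition T_r (y : 'I_3 -> plane) (r : R) (i : 'I_3) (x : plane) : set plane :=
  [set p | exists2 z : 'I_3 -> plane,
     [/\ similar y z, same_orientation y z, z i = y i
       & exists2 L, is_ell_r y r i x L & opp_edge z i `<=` L]
   & triangle z p].

Definition N_PE (y : 'I_3 -> plane) (v : plane -> 'I_3) (r : R) (x : plane) :
    set plane :=
  if x \in range y then [set x] else T_r y r (v x) x `&` triangle y.

End PlaneGeometry.

Section Graphs.
Context {R : realType} {n : nat}.

Definition pcd (y : 'I_3 -> R * R) (v : R * R -> 'I_3) (r : R)
    (x : 'I_n -> R * R) : rel 'I_n :=
  fun i j => (i != j) && (x j \in N_PE y v r (x i)).

Definition reflexivity_graph (g : rel 'I_n) : rel 'I_n :=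
  fun i j => g i j && g j i.

Definition underlying_graph (g : rel 'I_n) : rel 'I_n :=
  fun i j => g i j || g j i.

Definition rel_arc_density (g : rel 'I_n) : R :=
  #|[pred a : 'I_n * 'I_n | g a.1 a.2]|%:R / (n * n.-1)%:R.

(* For a symmetric g: each edge is counted once, with its ends in order. *)
Definition rel_edge_density (g : rel 'I_n) : R :=
  #|[pred a : 'I_n * 'I_n | (a.1 < a.2)%N && g a.1 a.2]|%:R / 'C(n, 2)%:R.

End Graphs.

Section Probability.
Context {R : realType} {d : measure_display} {Omega : measurableType d}.
Variable P : probability Omega R.
Local Open Scope ereal_scope.

Definition lebesgue2 : set (R * R) -> \bar R :=
  (@lebesgue_measure R \x @lebesgue_measure R).

Definition uniform_on (T : set (R * R)) (X : {RV P >-> (R * R)%type}) : Prop :=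
  forall A : set (R * R), measurable A ->
    distribution P X A = lebesgue2 (A `&` T) * ((fine (lebesgue2 T))^-1)%:E.

Definition mutually_independent d' (E : measurableType d') n
    (X : 'I_n -> {RV P >-> E}) : Prop :=
  forall (J : {set 'I_n}) (A : 'I_n -> set E), (forall i, measurable (A i)) ->
    P [set w | forall i, i \in J -> A i (X i w)]
    = \prod_(i in J) P (X i @^-1` A i).

Definition st_lt (U V : Omega -> R) : Prop :=
  (forall t : R, P [set w | (V w <= t)%R] <= P [set w | (U w <= t)%R]) /\
  (exists t : R, P [set w | (V w <= t)%R] < P [set w | (U w <= t)%R]).

End Probability.

(* Main.v *)
From mathcomp Require Import all_boot all_order all_algebra ring lra zify.
From mathcomp Require Import all_classical all_reals all_analysis.
From mathcomp Require Import measurable_realfun.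
Require Import Defs.

Import Order.TTheory GRing.Theory Num.Theory.
Local Open Scope classical_set_scope.
Local Open Scope ring_scope.

(** The two inequalities hold pointwise, before any probability enters.  Among
    the two possible arcs between a pair of points, the reflexivity graph counts
    the pair when both are present and the underlying graph when at least one
    is, so that the number of arcs is the sum of the two numbers of edges
    ([card_arcs]).  As n (n - 1) is twice the number of pairs, the arc density
    is the mean of the two edge densities, and lies between them
    ([density_sandwich]).  Inclusion of the events {V <= t} in {U <= t} gives
    the weak stochastic order, once these events are known to be measurable.

    Strictness needs one event of positive probability on which the densities
    are separated by a fixed level ([st_lt_pointwise]).  Take the event that
    every X_i falls near y 0, at a distance from y 0 (measured orthogonally to
    the opposite edge) which shrinks by a factor of at least r from each index
    to the next.  There, X_j lies in the proximity region of X_i exactly when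
    i < j, so the digraph is a transitive tournament: it has no symmetric pair,
    every pair is joined, and the three densities are 0, c / 2 and c, where
    c > 0 ([density_tournament]).  The levels 0 and c / 2 separate them.  The
    event is a product of events that each contain a small square, hence has
    positive probability by independence and uniformity.  Since r < 2, scales in
    ratio 2 suffice.

    What remains is to make T_r(x) explicit, both for the measurability of the
    arcs and for the computation on that event.  In barycentric coordinates b_j,
    T_r(x) is the image of the triangle under the homothety of center
    v(x) = y i and ratio s = r (1 - b_i(x)) ([T_rP]): the metric conditions on
    the line force its position ([is_ell_rP]), and a similar triangle with the
    same orientation, a common vertex and a parallel opposite edge is homothetic
    ([similar_homothety]).  Membership is then a system of polynomial
    inequalities.  It is established for every x in the plane, because the
    X_i are in the triangle only almost surely and the probability space is not
    assumed complete: the arcs must be measurable everywhere. *)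

(** * Plane algebra *)

Definition cross {R : realType} (a b : R * R) : R := a.1 * b.2 - a.2 * b.1.
Definition dot {R : realType} (a b : R * R) : R := a.1 * b.1 + a.2 * b.2.

Lemma pair_coordE {R : realType} :
  ((forall p q : R * R, ((p + q).1 = p.1 + q.1)%R)
  * (forall p q : R * R, ((p + q).2 = p.2 + q.2)%R)
  * (forall p : R * R, ((- p).1 = - p.1)%R)
  * (forall p : R * R, ((- p).2 = - p.2)%R)
  * (forall t (p : R * R), ((t *: p).1 = t * p.1)%R)
  * (forall t (p : R * R), ((t *: p).2 = t * p.2)%R))%type.
Proof. by []. Qed.

Lemma pair_ext {R : realType} (p q : R * R) : p.1 = q.1 -> p.2 = q.2 -> p = q.
Proof. by case: p q => [? ?] [? ?] /= -> ->. Qed.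

Lemma ord3P (i : 'I_3) : [\/ i = 0, i = 1 | i = 2%:R].
Proof.
case: i => -[|[|[|//]]] Hi; [apply: Or31|apply: Or32|apply: Or33]; exact: val_inj.
Qed.

Lemma sum3 (V : nmodType) (F : 'I_3 -> V) :
  \sum_i F i = F 0 + F 1 + F 2%:R.
Proof.
rewrite !big_ord_recl big_ord0 addr0 addrA.
by congr (F _ + F _ + F _); apply: val_inj.
Qed.

Lemma add3E : ((0 + 1 = 1 :> 'I_3)%R * (0 + 2%:R = 2%:R :> 'I_3)%R
  * (1 + 1 = 2%:R :> 'I_3)%R * (1 + 2%:R = 0 :> 'I_3)%R
  * (2%:R + 1 = 0 :> 'I_3)%R * (2%:R + 2%:R = 1 :> 'I_3)%R)%type.
Proof. by do !split; apply: val_inj. Qed.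

Lemma signed_area2_cyc {R : realType} (y : 'I_3 -> R * R) (i : 'I_3) :
  signed_area2 y = cross (y (i + 1) - y i) (y (i + 2%:R) - y i).
Proof.
rewrite /signed_area2 /cross !pair_coordE.
by case: (ord3P i) => ->; rewrite !add3E; ring.
Qed.

Lemma signed_area2_neq0 {R : realType} (y : 'I_3 -> R * R) :
  ~ collinear3 y -> signed_area2 y != 0.
Proof.
move=> ncol; apply/eqP => A0; apply: ncol.
have [e0|e0] := eqVneq (y 1) (y 0).
  have [f0|f0] := eqVneq (y 2%:R) (y 0).
    exists (y 0), (1, 0); split.
      by apply/eqP => -[] /eqP; rewrite oner_eq0.
    move=> i; exists 0 => //; rewrite scale0r addr0.
    by case: (ord3P i) => ->.
  exists (y 0), (y 2%:R - y 0); split; first by rewrite subr_eq0.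
  move=> i; case: (ord3P i) => ->.
  - by exists 0 => //; rewrite scale0r addr0.
  - by exists 0 => //; rewrite scale0r addr0.
  - by exists 1 => //; rewrite scale1r addrC subrK.
exists (y 0), (y 1 - y 0); split; first by rewrite subr_eq0.
move=> i; case: (ord3P i) => ->.
- by exists 0 => //; rewrite scale0r addr0.
- by exists 1 => //; rewrite scale1r addrC subrK.
move: A0; rewrite /signed_area2.
set a := (y 1).1 - _; set b := (y 1).2 - _.
set c := (y 2%:R).1 - _; set d := (y 2%:R).2 - _ => A0.
have [a0|a0] := eqVneq a 0.
  have b0 : b != 0.
    apply: contraNneq e0 => b0; apply/eqP; apply: pair_ext; apply/eqP.
      by rewrite -subr_eq0 -/a a0.
    by rewrite -subr_eq0 -/b b0.
  exists (d / b) => //; apply: pair_ext; rewrite !pair_coordE -/a -/b.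
    have : b * c = 0 by move: A0; rewrite a0; lra.
    move/eqP; rewrite mulf_eq0 (negbTE b0) /= => /eqP c0.
    by rewrite a0 mulr0 addr0; apply/eqP; rewrite eq_sym -subr_eq0; apply/eqP.
  by rewrite divfK // addrC subrK.
exists (c / a) => //; apply: pair_ext; rewrite !pair_coordE -/a -/b.
  by rewrite divfK // addrC subrK.
suff -> : c / a * b = d by rewrite addrC subrK.
by apply: (mulfI a0); rewrite mulrA mulrCA divff // mulr1; lra.
Qed.

(** * Distances to lines, and the line l_r(y i, x) *)

Lemma sqr_dist {R : realType} (p q : R * R) :
  dist p q ^+ 2 = (p.1 - q.1) ^+ 2 + (p.2 - q.2) ^+ 2.
Proof. by rewrite sqr_sqrtr // addr_ge0 ?sqr_ge0. Qed.

Lemma dist_ge0 {R : realType} (p q : R * R) : 0 <= dist p q.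
Proof. exact: sqrtr_ge0. Qed.

Lemma sqr_norm_gt0 {R : realType} {e : R * R} : e != 0 -> 0 < dot e e.
Proof.
move=> e0; rewrite lt_neqAle /dot -!expr2 addr_ge0 ?sqr_ge0 // andbT eq_sym.
apply: contraNneq e0 => /eqP; rewrite paddr_eq0 ?sqr_ge0 // !sqrf_eq0.
by move=> /andP[/eqP h1 /eqP h2]; apply/eqP/pair_ext.
Qed.

(** The component of p + t e - q orthogonal to e does not depend on t, and its
    length is |cross (p - q) e| / |e|; the component along e vanishes for exactly
    one t.  This is the distance from a point to a line. *)
Lemma dist_parallel {R : realType} (e p q : R * R) : e != 0 ->
  [/\ forall t, `|cross (p - q) e| / Num.sqrt (dot e e) <= dist (p + t *: e) q
    & exists t,
      dist (p + t *: e) q = `|cross (p - q) e| / Num.sqrt (dot e e)].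
Proof.
move=> e0; have ee := sqr_norm_gt0 e0.
have see : 0 < Num.sqrt (dot e e) by rewrite sqrtr_gt0.
(* Pythagoras: the orthogonal component plus the component along e. *)
have id2 t : (cross (p - q) e / Num.sqrt (dot e e)) ^+ 2
    + (dot (p - q) e + t * dot e e) ^+ 2 / dot e e
    = dist (p + t *: e) q ^+ 2.
  rewrite sqr_dist expr_div_n sqr_sqrtr ?ltW // !pair_coordE.
  apply: (mulIf (lt0r_neq0 ee)); rewrite mulrDl !divfK ?lt0r_neq0 //.
  by rewrite /cross /dot !pair_coordE; ring.
have nE : `|cross (p - q) e| / Num.sqrt (dot e e)
    = `|cross (p - q) e / Num.sqrt (dot e e)|.
  by rewrite normrM normfV (gtr0_norm see).
split=> [t|].
  rewrite nE -(ger0_norm (dist_ge0 _ _)) -ler_sqr ?nnegrE // !real_normK ?num_real //.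
  by rewrite -id2 lerDl divr_ge0 ?sqr_ge0 // ltW.
exists (- (dot (p - q) e / dot e e)).
rewrite nE; apply/eqP; rewrite -(eqrXn2 (n := 2)) ?dist_ge0 ?normr_ge0 //.
rewrite real_normK ?num_real // -id2.
by rewrite mulNr divfK ?lt0r_neq0 // subrr expr0n mul0r addr0.
Qed.

Lemma inf_attained {R : realType} (A : set R) (a : R) :
  A a -> (forall b, A b -> a <= b) -> inf A = a.
Proof.
move=> Aa lbA; apply/eqP; rewrite eq_le; apply/andP; split.
  by apply: ge_inf => //; exists a => b /lbA.
by apply: lb_le_inf; [exists a|move=> b /lbA].
Qed.

Lemma dist_pt_line {R : realType} (a p e : R * R) : e != 0 ->
  dist_pt_set a (line_dir p e) = `|cross (p - a) e| / Num.sqrt (dot e e).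
Proof.
move=> e0; have [lb [t tE]] := dist_parallel e p a e0.
have dC (b c : R * R) : dist b c = dist c b.
  by rewrite /dist -(sqrrN (b.1 - _)) -(sqrrN (b.2 - _)) !opprB.
apply: inf_attained.
  by exists (p + t *: e); [exists t|rewrite dC].
by move=> _ [_ [s _ <-] <-]; rewrite dC.
Qed.

(** A difference of points of two parallel lines with direction e only depends,
    up to a multiple of e, on the lines: the distance reduces to the one from
    a point to a line. *)
Lemma dist_line_line {R : realType} (p q e : R * R) : e != 0 ->
  dist_set_set (line_dir p e) (line_dir q e)
  = `|cross (p - q) e| / Num.sqrt (dot e e).
Proof.
move=> e0; have [lb [t tE]] := dist_parallel e p q e0.
apply: inf_attained.
  exists (p + t *: e); first by exists t.
  by exists q => //; exists 0 => //; rewrite scale0r addr0.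
move=> _ [_ [s _ <-] [_ [s' _ <-] <-]].
have -> : dist (p + s *: e) (q + s' *: e) = dist (p + (s - s') *: e) q.
  by rewrite /dist !pair_coordE; congr (Num.sqrt (_ ^+ 2 + _ ^+ 2)); ring.
exact: lb.
Qed.

(** On parallels to the edge e, the signed distance to y i is proportional to
    cross (p - y i) e.  The first metric condition leaves the two values r u and
    - r u, where u is the value at x; the strict inequality of the second
    excludes - r u, which is at distance (1 + r) |u| >= r |u| from x, and
    excludes u = 0. *)
Lemma is_ell_rP {R : realType} (y : 'I_3 -> R * R) (r : R) (i : 'I_3)
    (x : R * R) (L : set (R * R)) : 1 <= r ->
  y (i + 2%:R) - y (i + 1) != 0 ->
  is_ell_r y r i x L <->
  cross (x - y i) (y (i + 2%:R) - y (i + 1)) != 0 /\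
  exists2 p, L = parallel_edge y i p &
    cross (p - y i) (y (i + 2%:R) - y (i + 1))
    = r * cross (x - y i) (y (i + 2%:R) - y (i + 1)).
Proof.
move=> r1; rewrite /is_ell_r /parallel_edge.
set e := y (i + 2%:R) - _ => e0.
have see : 0 < Num.sqrt (dot e e) by rewrite sqrtr_gt0 sqr_norm_gt0.
have cross_sub p : cross (x - p) e = cross (x - y i) e - cross (p - y i) e.
  by rewrite /cross !pair_coordE; ring.
have ratio p : `|cross (p - y i) e| / Num.sqrt (dot e e)
      = r * (`|cross (x - y i) e| / Num.sqrt (dot e e))
    <-> `|cross (p - y i) e| = r * `|cross (x - y i) e|.
  rewrite mulrA; split=> [|-> //].
  by move/(mulIf (invr_neq0 (lt0r_neq0 see))).
split=> [[[p ->]]|[u0 [p -> pE]]].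
  rewrite !dist_pt_line // dist_line_line // ltr_pM2r ?invr_gt0 // (cross_sub p).
  set u := cross (x - y i) e; set c := cross (p - y i) e.
  move=> /ratio; rewrite -/u -/c => cu lt_uc.
  have c0 : c != 0.
    by apply: contraTneq lt_uc => ->; rewrite normr0 normr_lt0.
  have u0 : u != 0.
    by apply: contra_neq c0 => u0; apply/eqP; rewrite -normr_eq0 cu u0 normr0 mulr0.
  split=> //; exists p => //; rewrite -/u -/c.
  have r0 : 0 <= r by exact: le_trans ler01 r1.
  move/eqP: cu; rewrite -{1}(ger0_norm r0) -normrM eqr_norm2 => /orP[/eqP //|/eqP cE].
  move: lt_uc; rewrite cE normrN opprK -{1}(mul1r u) -mulrDl !normrM.
  rewrite ltr_pM2r ?normr_gt0 // !ger0_norm ?addr_ge0 //; lra.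
split.
- by exists p.
- by rewrite !dist_pt_line //; apply/ratio; rewrite pE normrM ger0_norm ?(le_trans ler01).
- rewrite dist_pt_line // dist_line_line // ltr_pM2r ?invr_gt0 // (cross_sub p) pE.
  set u := cross _ _ in u0 *.
  rewrite -{1}(mul1r u) -mulrBl !normrM ltr_pM2r ?normr_gt0 //.
  by rewrite ler0_norm ?subr_le0 // ger0_norm ?(le_trans ler01) //; lra.
Qed.

(** * Barycentric coordinates *)

(** The barycentric coordinate of p at the vertex y i, as a ratio of signed
    areas: p and the edge opposite y i over the whole triangle. *)
Definition bar {R : realType} (y : 'I_3 -> R * R) (i : 'I_3) (p : R * R) : R :=
  cross (y (i + 1) - p) (y (i + 2%:R) - p) / signed_area2 y.

Definition homothety {R : realType} (c : R * R) (s : R) (p : R * R) : R * R :=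
  c + s *: (p - c).

Lemma bar_vertex {R : realType} (y : 'I_3 -> R * R) (i j : 'I_3) :
  signed_area2 y != 0 -> bar y i (y j) = (i == j)%:R.
Proof.
move=> A0; rewrite /bar; have [->|] := eqVneq i j.
  by rewrite -signed_area2_cyc divff.
move=> ij; suff -> : cross (y (i + 1) - y j) (y (i + 2%:R) - y j) = 0.
  by rewrite mul0r.
move: ij; rewrite /cross !pair_coordE.
by case: (ord3P i) => ->; case: (ord3P j) => -> //= _; rewrite !add3E; ring.
Qed.

Lemma bar_compl {R : realType} (y : 'I_3 -> R * R) (i : 'I_3) (p : R * R) :
  signed_area2 y != 0 ->
  cross (p - y i) (y (i + 2%:R) - y (i + 1))
  = signed_area2 y * (1 - bar y i p).
Proof.
move=> A0; rewrite /bar mulrBr mulr1 mulrC divfK // (signed_area2_cyc y i).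
by rewrite /cross !pair_coordE; ring.
Qed.

(** Only the affinity in p matters when [bar] is evaluated at combinations,
    midpoints or homothetic points, or is bounded or measured. *)
Lemma bar_affine {R : realType} (y : 'I_3 -> R * R) (i : 'I_3) :
  exists a b c : R, forall p, bar y i p = a * p.1 + b * p.2 + c.
Proof.
pose b := y (i + 1); pose c := y (i + 2%:R); pose A := signed_area2 y.
exists ((b.2 - c.2) / A), ((c.1 - b.1) / A), (cross b c / A) => p.
by rewrite /bar /cross !pair_coordE -/b -/c -/A; ring.
Qed.

Lemma bar_comb {R : realType} (y : 'I_3 -> R * R) (i : 'I_3) n
    (w : 'I_n -> R) (q : 'I_n -> R * R) : \sum_k w k = 1 ->
  bar y i (\sum_k w k *: q k) = \sum_k w k * bar y i (q k).
Proof.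
move=> w1; have [a [b [c barE]]] := bar_affine y i.
rewrite barE (raddf_sum (@fst R R)) (raddf_sum (@snd R R)) /= !mulr_sumr.
rewrite -[c]mulr1 -w1 mulr_sumr -!big_split /=.
by apply: eq_bigr => k _; rewrite barE /= -![w k *: _]/(w k * _); ring.
Qed.

Lemma bar_sum {R : realType} (y : 'I_3 -> R * R) (p : R * R) :
  signed_area2 y != 0 -> \sum_i bar y i p = 1.
Proof.
move=> A0; rewrite sum3 /bar !add3E -!mulrDl; apply: (mulIf A0).
by rewrite divfK // mul1r /signed_area2 /cross !pair_coordE; ring.
Qed.

Lemma bar_decomp {R : realType} (y : 'I_3 -> R * R) (p : R * R) :
  signed_area2 y != 0 -> p = \sum_i bar y i p *: y i.
Proof.
move=> A0; rewrite sum3 /bar !add3E.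
have clear_den n0 n1 n2 a b c : (n0 / signed_area2 y * a
    + n1 / signed_area2 y * b + n2 / signed_area2 y * c) * signed_area2 y
    = n0 * a + n1 * b + n2 * c by field.
apply: pair_ext; apply: (mulIf A0); rewrite !pair_coordE clear_den;
  by rewrite /signed_area2 /cross !pair_coordE; ring.
Qed.

Lemma bar_homothety {R : realType} (y : 'I_3 -> R * R) (i j : 'I_3) (s : R)
    (p : R * R) : signed_area2 y != 0 ->
  bar y j (homothety (y i) s p) = (j == i)%:R + s * (bar y j p - (j == i)%:R).
Proof.
move=> A0; rewrite -(bar_vertex y j i A0); have [a [b [c barE]]] := bar_affine y j.
by rewrite !barE /homothety !pair_coordE; ring.
Qed.

(** * The triangle T_r(x) *)

Lemma triangle_comb {R : realType} (y : 'I_3 -> R * R) (p : R * R) :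
  triangle y p <-> exists w : 'I_3 -> R,
    [/\ forall k, 0 <= w k, \sum_k w k = 1 & p = \sum_k w k *: y k].
Proof.
have nthE (k : 'I_3) : [:: y 0; y 1; y 2%:R]`_k = y k.
  by case: (ord3P k) => ->.
split=> -[w [w0 w1 pE]]; exists w; split=> //; rewrite {}pE.
  by apply: eq_bigr => k _; congr (_ *: _); exact: (nthE k).
by apply: eq_bigr => k _; congr (_ *: _); exact: (esym (nthE k)).
Qed.

Lemma triangleP {R : realType} (y : 'I_3 -> R * R) (p : R * R) :
  signed_area2 y != 0 -> triangle y p <-> forall i, 0 <= bar y i p.
Proof.
move=> A0; split=> [/triangle_comb[w [w0 w1 ->]] i|b0].
  rewrite bar_comb // sumr_ge0 // => k _.
  by rewrite bar_vertex // mulr_ge0 ?ler0n.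
by apply/triangle_comb; exists (fun i => bar y i p); split=> //;
  [exact: bar_sum|exact: bar_decomp].
Qed.

Lemma triangle_homothety {R : realType} (y : 'I_3 -> R * R) (c : R * R) (s : R)
    (p : R * R) : s != 0 ->
  triangle (homothety c s \o y) p <-> triangle y (homothety c s^-1 p).
Proof.
move=> s0.
have comb (t : R) (z : 'I_3 -> R * R) (w : 'I_3 -> R) : \sum_k w k = 1 ->
    \sum_k w k *: homothety c t (z k) = homothety c t (\sum_k w k *: z k).
  move=> w1; rewrite /homothety.
  under eq_bigr do rewrite scalerDr scalerA mulrC -scalerA scalerBr.
  by rewrite big_split /= -scaler_suml w1 scale1r -scaler_sumr sumrB -scaler_suml
    w1 scale1r.
have homK t (t0 : t != 0) : cancel (homothety c t) (homothety c t^-1).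
  by move=> q; rewrite /homothety (addrC c (t *: _)) addrK scalerA mulVf // scale1r addrC subrK.
split=> /triangle_comb[w [w0 w1 pE]]; apply/triangle_comb; exists w; split=> //.
  by rewrite pE /= comb // homK.
rewrite /= comb // -pE; have := homK s^-1; rewrite invrK => -> //.
by rewrite invr_eq0.
Qed.

(** e and e rotated by a right angle form an orthogonal basis, in which [dot] and
    [cross] against e are the coordinates up to the factor |e|^2. *)
Lemma dot_cross_inj {R : realType} (e p q : R * R) : e != 0 ->
  dot p e = dot q e -> cross p e = cross q e -> p = q.
Proof.
move=> e0 hd hc; have ee := sqr_norm_gt0 e0.
apply: pair_ext; apply: (mulfI (lt0r_neq0 ee)).
  have id1 (r : R * R) : dot e e * r.1 = dot r e * e.1 + cross r e * e.2.
    by rewrite /dot /cross; ring.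
  by rewrite !id1 hd hc.
have id2 (r : R * R) : dot e e * r.2 = dot r e * e.2 - cross r e * e.1.
  by rewrite /dot /cross; ring.
by rewrite !id2 hd hc.
Qed.

Lemma lagrange_id {R : realType} (p q : R * R) :
  dot p p * dot q q = dot p q ^+ 2 + cross p q ^+ 2.
Proof. by rewrite /dot /cross; ring. Qed.

Lemma sub_vertex_neq0 {R : realType} (y : 'I_3 -> R * R) (i : 'I_3) :
  signed_area2 y != 0 -> y (i + 2%:R) - y (i + 1) != 0.
Proof.
apply: contra_neq => e0; rewrite (signed_area2_cyc y i).
have -> : y (i + 2%:R) = y (i + 1) by apply/eqP; rewrite -subr_eq0 e0.
by rewrite /cross; ring.
Qed.

Lemma sub_chain (V : zmodType) (a b c : V) : (a - b) + (b - c) = a - c.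
Proof. by rewrite addrA subrK. Qed.

(** Put P = z (i+1) - y i, Q = z (i+2) - y i, B = y (i+1) - y i and let e be the
    edge opposite y i.  The two last hypotheses give Q - P = tau e, and the
    similarity |tau| = k.  Comparing |Q| = k |B + e| with |P| = k |B| gives
    P.e = tau B.e, so P is tau B or its mirror image in the direction of e; the
    orientation excludes the mirror image. *)
Lemma similar_homothety {R : realType} (y z : 'I_3 -> R * R) (i : 'I_3) (t : R) :
  signed_area2 y != 0 -> similar y z -> same_orientation y z -> z i = y i ->
  cross (z (i + 1) - y i) (y (i + 2%:R) - y (i + 1)) = t * signed_area2 y ->
  cross (z (i + 2%:R) - y i) (y (i + 2%:R) - y (i + 1)) = t * signed_area2 y ->
  z = homothety (y i) t \o y.
Proof.
move=> A0 [k k0 sim] ori zi.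
have e0 := sub_vertex_neq0 y i A0.
have sim2 j l : dot (z j - z l) (z j - z l) = k ^+ 2 * dot (y j - y l) (y j - y l).
  have sqd (u v : R * R) : dot (u - v) (u - v) = dist u v ^+ 2.
    by rewrite sqr_dist /dot !pair_coordE !expr2.
  by rewrite !sqd sim exprMn.
have simP := sim2 (i + 1) i; have simQ := sim2 (i + 2%:R) i.
have simE := sim2 (i + 2%:R) (i + 1).
move: ori; rewrite /same_orientation (signed_area2_cyc z i).
rewrite zi in simP simQ *; move: simP simQ simE.
have AE : signed_area2 y
    = cross (y (i + 1) - y i) (y (i + 2%:R) - y (i + 1)).
  by rewrite (signed_area2_cyc y i) /cross !pair_coordE; ring.
have -> : z (i + 2%:R) - z (i + 1) = (z (i + 2%:R) - y i) - (z (i + 1) - y i).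
  by rewrite opprB sub_chain.
have -> : y (i + 2%:R) - y i = (y (i + 1) - y i) + (y (i + 2%:R) - y (i + 1)).
  by rewrite [RHS]addrC sub_chain.
move: AE e0; set e := y (i + 2%:R) - y (i + 1); set B := y (i + 1) - y i.
set P := z (i + 1) - y i; set Q := z (i + 2%:R) - y i.
move=> AE e0 simP simQ simE ori crP crQ.
have ee := sqr_norm_gt0 e0.
have [tau QE] : exists tau, Q = P + tau *: e.
  exists (dot (Q - P) e / dot e e).
  rewrite addrC; apply/eqP; rewrite -subr_eq; apply/eqP.
  apply: (dot_cross_inj e) => //.
    have dotZ a : dot (a *: e) e = a * dot e e by rewrite /dot !pair_coordE; ring.
    by rewrite dotZ divfK // lt0r_neq0.
  have crB : cross (Q - P) e = cross Q e - cross P e.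
    by rewrite /cross !pair_coordE; ring.
  by rewrite crB crP crQ /cross !pair_coordE; ring.
have tau2 : tau ^+ 2 = k ^+ 2.
  apply: (mulIf (lt0r_neq0 ee)); rewrite -simE QE /dot !pair_coordE; ring.
have tau0 : tau != 0 by rewrite -sqrf_eq0 tau2 sqrf_eq0 gt_eqF.
have dotP : dot P e = tau * dot B e.
  apply: (mulfI tau0); rewrite mulrA -expr2.
  move: simQ; rewrite QE.
  have dotD (u w : R * R) : dot (u + w) (u + w) = dot u u + 2%:R * dot u w + dot w w.
    by rewrite /dot !pair_coordE; ring.
  have dotZ (u : R * R) : dot u (tau *: e) = tau * dot u e.
    by rewrite /dot !pair_coordE; ring.
  have dotZZ : dot (tau *: e) (tau *: e) = tau ^+ 2 * dot e e.
    by rewrite /dot !pair_coordE; ring.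
  rewrite (dotD P) (dotD B) simP dotZ dotZZ tau2; lra.
have sgt : 0 < tau * t.
  move: ori; rewrite QE.
  have -> : cross P (P + tau *: e) = tau * cross P e.
    by rewrite /cross !pair_coordE; ring.
  rewrite crP mulrA sgrM => /eqP.
  rewrite -[X in _ == X]mul1r (inj_eq (mulIf _)) ?sgr_eq0 //.
  by rewrite sgr_cp0.
have t2 : t ^+ 2 = tau ^+ 2.
  apply: (mulIf (_ : signed_area2 y ^+ 2 != 0)); first by rewrite sqrf_eq0.
  have := lagrange_id P e; rewrite crP dotP simP.
  have := lagrange_id B e; rewrite -AE -tau2 -mulrA => ->.
  rewrite !exprMn; lra.
have tE : t = tau.
  apply/eqP; have : (t - tau) * (t + tau) = 0 by rewrite -subr_sqr t2 subrr.
  move/eqP; rewrite mulf_eq0 subr_eq0 => /orP[//|/eqP h].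
  have /eqP := h; rewrite addr_eq0 => /eqP tN.
  by move: sgt; rewrite tN mulrN oppr_gt0 -expr2 ltNge sqr_ge0.
have PE : P = t *: B.
  apply: (dot_cross_inj e) => //.
    by rewrite dotP tE /dot !pair_coordE; ring.
  by rewrite crP AE /cross !pair_coordE; ring.
have zE (p q : R * R) : p - y i = t *: (q - y i) -> p = homothety (y i) t q.
  by rewrite /homothety => <-; rewrite addrC subrK.
apply: funext => j; apply: zE.
have [->|->|->] : [\/ j = i, j = i + 1 | j = i + 2%:R].
  case: (ord3P i) => ->; case: (ord3P j) => ->; rewrite !add3E;
    by [apply: Or31 | apply: Or32 | apply: Or33].
- by rewrite zi !subrr scaler0.
- exact: PE.
- have -> : z (i + 2%:R) - y i = P + t *: e by rewrite -/Q QE tE.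
  by rewrite PE -scalerDr /B /e [X in _ *: X]addrC sub_chain.
Qed.

(** The inequalities say that the homothety of center y i and ratio 1 / s sends p
    into the triangle; they are multiplied by s^2, which makes them polynomial
    in the coordinates of x and p, whatever the sign of s.  That sign is
    negative when x is on the far side of the parallel through y i to the
    opposite edge. *)
Lemma T_rP {R : realType} (y : 'I_3 -> R * R) (r : R) (i : 'I_3)
    (x p : R * R) : signed_area2 y != 0 -> 1 <= r ->
  let s := r * (1 - bar y i x) in
  T_r y r i x p <->
  bar y i x != 1 /\ forall j, 0 <= s * (bar y j p + (j == i)%:R * (s - 1)).
Proof.
move=> A0 r1 s.
have e0 := sub_vertex_neq0 y i A0.
have r0 : r != 0 by rewrite gt_eqF // (lt_le_trans ltr01).
have u0E : (cross (x - y i) (y (i + 2%:R) - y (i + 1)) != 0) = (bar y i x != 1).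
  by rewrite bar_compl // mulf_eq0 (negbTE A0) /= subr_eq0 eq_sym.
have in_tri : bar y i x != 1 -> triangle (homothety (y i) s \o y) p <->
    forall j, 0 <= s * (bar y j p + (j == i)%:R * (s - 1)).
  move=> u0; have s0 : s != 0 by rewrite mulf_neq0 // subr_eq0 eq_sym.
  have scale j : s ^+ 2 * bar y j (homothety (y i) s^-1 p)
      = s * (bar y j p + (j == i)%:R * (s - 1)).
    by rewrite bar_homothety //; field; exact: s0.
  have s2 : 0 < s ^+ 2 by rewrite exprn_even_gt0.
  rewrite triangle_homothety // triangleP //; split=> h j; move: (h j).
    by rewrite -scale (pmulr_rge0 _ s2).
  by rewrite -scale (pmulr_rge0 _ s2).
split=> [[z [sim ori zi [L /(is_ell_rP _ _ _ _ _ r1 e0) [u0 [q -> qE]] sub]] zp]|[u0 h]].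
  rewrite u0E in u0; split=> //; apply/(in_tri u0).
  suff <- : z = homothety (y i) s \o y by [].
  have on_line q' : parallel_edge y i q q' ->
      cross (q' - y i) (y (i + 2%:R) - y (i + 1)) = s * signed_area2 y.
    move=> [t _ <-]; rewrite mulrC /s mulrCA -bar_compl // -qE.
    by rewrite /cross !pair_coordE; ring.
  apply: similar_homothety => //; apply: on_line; apply: sub.
    exists (fun k => (k == 0)%:R); split=> [k||].
    - exact: ler0n.
    - by rewrite !big_ord_recl big_ord0 /= !addr0.
    - by rewrite !big_ord_recl big_ord0 /= scale1r scale0r !addr0.
  exists (fun k => (k != 0)%:R); split=> [k||].
  - exact: ler0n.
  - by rewrite !big_ord_recl big_ord0 /= add0r addr0.
  - by rewrite !big_ord_recl big_ord0 /= scale1r scale0r addr0 add0r.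
have s0 : s != 0 by rewrite mulf_neq0 // subr_eq0 eq_sym.
exists (homothety (y i) s \o y); last exact/(in_tri u0).
split=> /=.
- exists `|s|; first by rewrite normr_gt0.
  move=> j k; rewrite -sqrtr_sqr /dist -sqrtrM ?sqr_ge0 //.
  by congr Num.sqrt; rewrite /homothety !pair_coordE; ring.
- rewrite /same_orientation.
  have -> : signed_area2 (homothety (y i) s \o y) = s ^+ 2 * signed_area2 y.
    by rewrite /signed_area2 /comp /homothety !pair_coordE; ring.
  by rewrite sgrM gtr0_sg ?mul1r // exprn_even_gt0.
- by rewrite /homothety subrr scaler0 addr0.
- exists (parallel_edge y i (homothety (y i) s (y (i + 1)))).
    apply/(is_ell_rP _ _ _ _ _ r1 e0); rewrite u0E; split=> //.
    exists (homothety (y i) s (y (i + 1))) => //.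
    rewrite [in RHS]bar_compl // mulrCA -/s (signed_area2_cyc y i).
    by rewrite /homothety /cross !pair_coordE; ring.
  move=> q [w [w0]]; rewrite !big_ord_recl !big_ord0 /= !addr0 => w1 ->.
  exists (s * w (lift ord0 ord0)) => //.
  have -> : w ord0 = 1 - w (lift ord0 ord0) by rewrite -w1; ring.
  by apply: pair_ext; rewrite /homothety !pair_coordE; ring.
Qed.

(** * Points near a vertex *)

(** Affine inequalities need only be checked at the four corners of the
    region. *)
Lemma vertex_region_bar {R : realType} (y : 'I_3 -> R * R) (k j : 'I_3)
    (x : R * R) : signed_area2 y != 0 ->
  vertex_region y k x -> bar y j x <= bar y k x.
Proof.
move=> A0 [w [w0 w1 ->]]; rewrite !bar_comb //; apply: ler_sum => m _.
apply: ler_wpM2l => //.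
have bar_mid i p q : bar y i (midpoint p q) = (bar y i p + bar y i q) / 2.
  have [a [b [c barE]]] := bar_affine y i.
  by rewrite !barE /midpoint !pair_coordE; field.
have bar_cen i : bar y i (centroid y) = 3^-1.
  have -> : centroid y = \sum_l 3^-1 *: y l by rewrite -scaler_sumr.
  rewrite bar_comb; last by rewrite sum3; field.
  rewrite -mulr_sumr sum3 !bar_vertex //.
  by case: (ord3P i) => -> /=; field.
case: m => [[|[|[|[|//]]]] /= _]; rewrite ?bar_mid ?bar_cen // !bar_vertex //.
all: case: (ord3P k) => ->; case: (ord3P j) => -> /=; lra.
Qed.

(** A coordinate larger than 1/2 exceeds the two others, whereas the coordinate
    of a region is maximal on it: x lies in one region only. *)
Lemma near_vertex {R : realType} (y : 'I_3 -> R * R) (v : R * R -> 'I_3)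
    (i : 'I_3) (x : R * R) : signed_area2 y != 0 -> vertex_choice y v ->
  (forall j, 0 < bar y j x) -> 1 / 2 < bar y i x -> ~ range y x /\ v x = i.
Proof.
move=> A0 vc b0 bi.
have rx : ~ range y x.
  move=> [k _ kx]; have := b0 (k + 1); rewrite -kx bar_vertex //.
  by case: (ord3P k) => -> /=; rewrite ltxx.
split=> //; apply: contraTeq bi => vi; rewrite -leNgt.
have tx : triangle y x by apply/triangleP => // j; exact: ltW.
have := vertex_region_bar _ _ i _ A0 (vc x tx rx).
have := bar_sum _ x A0; rewrite sum3.
move: vi (b0 0) (b0 1) (b0 2%:R).
by case: (ord3P i) => ->; case: (ord3P (v x)) => -> //= _; lra.
Qed.

Lemma bar_near {R : realType} (y : 'I_3 -> R * R) (p : R * R) (del : R) :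
  0 < del -> exists2 eps, 0 < eps & forall x : R * R,
    `|x.1 - p.1| < eps -> `|x.2 - p.2| < eps ->
    forall i, `|bar y i x - bar y i p| < del.
Proof.
move=> del0.
have one (i : 'I_3) : exists K, forall (eps : R) (x : R * R), 0 < eps ->
    `|x.1 - p.1| < eps -> `|x.2 - p.2| < eps ->
    `|bar y i x - bar y i p| <= K * eps.
  have [a [b [c barE]]] := bar_affine y i; exists (`|a| + `|b|) => eps x e0 h1 h2.
  have -> : bar y i x - bar y i p = a * (x.1 - p.1) + b * (x.2 - p.2).
    by rewrite !barE; ring.
  rewrite (le_trans (ler_normD _ _)) // !normrM mulrDl lerD //.
    by rewrite ler_wpM2l // ltW.
  by rewrite ler_wpM2l // ltW.
have [K KP] := choice one.
pose L := 1 + \sum_i `|K i|.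
have L0 : 0 < L by rewrite ltr_pwDl // sumr_ge0.
exists (del / L) => [|x h1 h2 i]; first exact: divr_gt0.
have e0 : 0 < del / L by exact: divr_gt0.
rewrite (le_lt_trans (KP i _ _ e0 h1 h2)) // mulrA ltr_pdivrMr // mulrC ltr_pM2l //.
rewrite (le_lt_trans (ler_norm _)) // /L (bigD1 i) //=.
have : 0 <= \sum_(j | j != i) `|K j| by apply: sumr_ge0.
lra.
Qed.

(** The part of the open angle at y 0 whose relative height, measured from y 0
    towards the opposite edge, is between lo and hi. *)
Definition strip {R : realType} (y : 'I_3 -> R * R) (lo hi : R) : set (R * R) :=
  [set x | [/\ 0 < bar y 1 x, 0 < bar y 2%:R x,
               lo < 1 - bar y 0 x & 1 - bar y 0 x < hi]].

(** A strip is open and contains points on the median from y 0.  A square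
    inside it serves as witness because its measure is a product of lengths. *)
Lemma strip_square {R : realType} (y : 'I_3 -> R * R) (lo hi : R) :
  signed_area2 y != 0 -> 0 < lo -> lo < hi ->
  exists A : set (R * R), [/\ measurable A, A `<=` strip y lo hi
    & (0 < lebesgue2 A)%E].
Proof.
move=> A0 lo0 lohi.
(* p is the point of the median from y 0 at the middle height; 1/4 of the width
   of the strip is less than both of its other coordinates u / 2. *)
pose u := (lo + hi) / 2.
pose w (k : 'I_3) : R := if k == 0 then 1 - u else u / 2.
pose p := \sum_k w k *: y k.
have barp i : bar y i p = w i.
  rewrite bar_comb; last by rewrite sum3 /w /=; field.
  rewrite (bigD1 i) //= bar_vertex // eqxx mulr1 big1 ?addr0 // => k ki.
  by rewrite bar_vertex // eq_sym (negbTE ki) mulr0.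
have [|eps e0 near] := bar_near y p ((hi - lo) / 4); first by lra.
exists (`]p.1 - eps, p.1 + eps[ `*` `]p.2 - eps, p.2 + eps[); split.
- exact: measurableX.
- move=> x [] /=; rewrite !in_itv /= => /andP[h1 h2] /andP[h3 h4].
  have := near x; rewrite !ltr_norml !ltrBrDr !ltrBlDr.
  have -> : - eps + p.1 < x.1 by lra.
  have -> : x.1 < eps + p.1 by lra.
  have -> : - eps + p.2 < x.2 by lra.
  have -> : x.2 < eps + p.2 by lra.
  move=> /(_ isT isT) h; move: (h 0) (h 1) (h 2%:R).
  rewrite !ltr_norml !barp /w /= /u => /andP[? ?] /andP[? ?] /andP[? ?].
  by split; lra.
- rewrite /lebesgue2 product_measure1E //= !lebesgue_measure_itv /= !lte_fin.
  have -> : p.1 - eps < p.1 + eps by lra.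
  have -> : p.2 - eps < p.2 + eps by lra.
  by rewrite -!EFinB mule_gt0 // lte_fin; lra.
Qed.

(** Near y 0 the region of x is the part of the triangle cut off at r times the
    height of x. *)
Lemma N_PE_strip {R : realType} (y : 'I_3 -> R * R) (v : R * R -> 'I_3) (r : R)
    (lo hi lo' hi' : R) (x p : R * R) :
  signed_area2 y != 0 -> vertex_choice y v -> 1 <= r ->
  0 < lo -> hi < 1 / 2 -> 0 < lo' -> hi' < 1 / 2 ->
  strip y lo hi x -> strip y lo' hi' p ->
  (p \in N_PE y v r x) = (1 - bar y 0 p <= r * (1 - bar y 0 x)).
Proof.
move=> A0 vc r1 lo0 hi1 lo'0 hi'1 [x1 x2 x3 x4] [p1 p2 p3 p4].
have [xr vx] : ~ range y x /\ v x = 0.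
  by apply: near_vertex => // [j|]; [case: (ord3P j) => -> //|]; lra.
have pt : triangle y p.
  by apply/triangleP => // j; case: (ord3P j) => ->; lra.
rewrite /N_PE; case: ifPn => [|_]; first by rewrite inE.
set s := r * _.
have s0 : 0 < s by rewrite /s mulr_gt0 //; lra.
apply/idP/idP; rewrite inE vx.
  move=> [/(T_rP _ _ _ _ _ A0 r1)[_ /(_ 0) h] _]; move: h.
  by rewrite -/s pmulr_rge0 //= mul1r; lra.
move=> h; split=> //; apply/(T_rP _ _ _ _ _ A0 r1); split.
  by rewrite lt_eqF //; lra.
by move=> j; rewrite -/s pmulr_rge0 //; case: (ord3P j) => -> /=; lra.
Qed.

(** * Counting arcs and edges *)

(** For each unordered pair, b + c = (b && c) + (b || c), where b and c tell
    which of its two arcs are present. *)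
Lemma card_arcs n (g : rel 'I_n) : (forall i, ~~ g i i) ->
  #|[pred a : 'I_n * 'I_n | g a.1 a.2]|
  = (#|[pred a : 'I_n * 'I_n | (a.1 < a.2)%N && reflexivity_graph g a.1 a.2]|
   + #|[pred a : 'I_n * 'I_n | (a.1 < a.2)%N && underlying_graph g a.1 a.2]|)%N.
Proof.
move=> gii.
have cardE (b : pred ('I_n * 'I_n)) : #|[pred a | b a]| = (\sum_a b a)%N.
  by rewrite -sum1_card big_mkcond; apply: eq_bigr => a _; rewrite inE; case: (b a).
rewrite !cardE -big_split /=.
rewrite (bigID (fun a : 'I_n * 'I_n => (a.1 < a.2)%N)) /=.
rewrite [RHS](bigID (fun a : 'I_n * 'I_n => (a.1 < a.2)%N)) /=.
rewrite [X in _ = (_ + X)%N]big1 ?addn0; last by move=> a /negbTE ->.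
rewrite [X in (_ + X)%N = _](bigID (fun a : 'I_n * 'I_n => (a.2 < a.1)%N)) /=.
rewrite [X in (_ + (_ + X))%N = _]big1 ?addn0; last first.
  move=> [i j] /=; rewrite -!leqNgt => /andP[ij ji].
  have -> : i = j by apply: val_inj; apply/eqP; rewrite eqn_leq ij ji.
  by rewrite (negbTE (gii j)).
have swapK : involutive (fun a : 'I_n * 'I_n => (a.2, a.1)) by case.
rewrite [X in (_ + X)%N = _](reindex_inj (inv_inj swapK)) /=.
rewrite [X in (_ + X)%N = _](eq_bigl (fun a : 'I_n * 'I_n => (a.1 < a.2)%N)); last first.
  by move=> a /=; case: ltngtP.
rewrite -big_split /=; apply: eq_bigr => a ->.
by rewrite /reflexivity_graph /underlying_graph; case: (g _ _); case: (g _ _).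
Qed.

Lemma rel_arc_densityE {R : realType} n (g : rel 'I_n) : (forall i, ~~ g i i) ->
  rel_arc_density g = (rel_edge_density (reflexivity_graph g)
                       + rel_edge_density (underlying_graph g)) / 2 :> R.
Proof.
move=> gii; rewrite /rel_arc_density /rel_edge_density card_arcs //.
have -> : (n * n.-1 = 'C(n, 2) * 2)%N by have := bin_ffact n 2; rewrite ffactnS ffactn1.
by rewrite natrD natrM invfM mulrA mulrDl.
Qed.

Lemma rel_edge_density_le {R : realType} n (g h : rel 'I_n) : subrel g h ->
  rel_edge_density g <= rel_edge_density h :> R.
Proof.
move=> gh; rewrite /rel_edge_density ler_wpM2r ?invr_ge0 ?ler0n // ler_nat.
by apply/subset_leq_card/fintype.subsetP => a; rewrite !inE => /andP[-> /gh].
Qed.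

Lemma density_sandwich {R : realType} n (g : rel 'I_n) : (forall i, ~~ g i i) ->
  rel_edge_density (reflexivity_graph g) <= rel_arc_density g :> R
  /\ rel_arc_density g <= rel_edge_density (underlying_graph g) :> R.
Proof.
move=> gii; have : rel_edge_density (reflexivity_graph g)
    <= rel_edge_density (underlying_graph g) :> R.
  by apply: rel_edge_density_le => i j /andP[gij _]; apply/orP; left.
by rewrite rel_arc_densityE //; lra.
Qed.

Lemma density_tournament {R : realType} n (g : rel 'I_n) : (1 < n)%N ->
  (forall i j, g i j = (i < j)%N) ->
  [/\ rel_edge_density (reflexivity_graph g) = 0 :> R,
      rel_arc_density g = rel_edge_density (underlying_graph g) / 2 :> R
    & 0 < rel_edge_density (underlying_graph g) :> R].
Proof.
move=> n1 gE.
have and0 : rel_edge_density (reflexivity_graph g) = 0 :> R.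
  rewrite /rel_edge_density eq_card0 ?mul0r // => a.
  by rewrite !inE /reflexivity_graph !gE; case: ltngtP.
split=> //; first by rewrite rel_arc_densityE ?and0 ?add0r // => i; rewrite gE ltnn.
rewrite /rel_edge_density divr_gt0 ?ltr0n ?bin_gt0 //; apply/card_gt0P.
exists (Ordinal (ltnW n1), Ordinal n1).
by rewrite !inE /underlying_graph !gE.
Qed.

(** * Measurability of the arcs and strict stochastic order *)

Section Measurability.
Context {R : realType} {d : measure_display} {Omega : measurableType d}.

Lemma measurable_set_bool (b : Omega -> bool) :
  measurable_fun setT b -> measurable [set w | b w].
Proof.
by move=> /(_ measurableT [set true]); rewrite setTI; apply.
Qed.

Lemma measurable_fun_set_bool (b : Omega -> bool) :
  measurable [set w | b w] -> measurable_fun setT b.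
Proof.
move=> mb; apply: (measurable_fun_bool true); rewrite setTI.
by rewrite preimage_true.
Qed.

Lemma measurable_forall (n : nat) (Q : 'I_n -> Omega -> Prop) :
  (forall k, measurable [set w | Q k w]) -> measurable [set w | forall k, Q k w].
Proof.
move=> mQ; have -> : [set w | forall k, Q k w] = \bigcap_k [set w | Q k w].
  by apply/seteqP; split=> w h k => [_|]; exact: h.
by apply: fin_bigcap_measurable => //; exact: finite_finset.
Qed.

Lemma measurable_exists (n : nat) (Q : 'I_n -> Omega -> Prop) :
  (forall k, measurable [set w | Q k w]) ->
  measurable [set w | exists k, Q k w].
Proof.
move=> mQ; have -> : [set w | exists k, Q k w] = \bigcup_k [set w | Q k w].
  by apply/seteqP; split=> w [k] => [h|_ h]; exists k.
by apply: fin_bigcup_measurable => //; exact: finite_finset.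
Qed.

Lemma measurable_count (T : finType) (b : T -> Omega -> bool) :
  (forall a, measurable_fun setT (b a)) ->
  measurable_fun setT (fun w => #|[pred a | b a w]|%:R : R).
Proof.
move=> mb.
have -> : (fun w => #|[pred a | b a w]|%:R : R)
    = (fun w => \sum_(a <- enum T) \1_[set w | b a w] w).
  apply: funext => w; rewrite -sum1_card natr_sum big_mkcond big_enum /=.
  apply: eq_bigr => a _; rewrite inE indicE mem_setE.
  by rewrite -[w \in b a]/(b a w); case: (b a w).
by apply: measurable_sum => a; apply: measurable_indic; exact: measurable_set_bool.
Qed.

Lemma measurable_eq_pt (X Y : Omega -> R * R) :
  measurable_fun setT X -> measurable_fun setT Y ->
  measurable [set w | X w = Y w].
Proof.
move=> mX mY.
have -> : [set w | X w = Y w]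
    = [set w | ((X w).1 == (Y w).1) && ((X w).2 == (Y w).2)].
  apply/seteqP; split=> w /= => [->|/andP[/eqP h1 /eqP h2]]; first by rewrite !eqxx.
  exact: pair_ext.
apply: measurable_set_bool; apply: measurable_and; apply: measurable_fun_eqr;
  exact: measurableT_comp.
Qed.

Lemma measurable_bar (y : 'I_3 -> R * R) (i : 'I_3) (X : Omega -> R * R) :
  measurable_fun setT X -> measurable_fun setT (fun w => bar y i (X w)).
Proof.
move=> mX; have [a [b [c barE]]] := bar_affine y i.
under eq_fun do rewrite barE.
apply: measurable_funD => //; apply: measurable_funD; apply: measurable_funM => //;
  exact: measurableT_comp.
Qed.

Lemma measurable_triangle (y : 'I_3 -> R * R) (X : Omega -> R * R) :
  signed_area2 y != 0 -> measurable_fun setT X ->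
  measurable [set w | triangle y (X w)].
Proof.
move=> A0 mX.
have -> : [set w | triangle y (X w)] = [set w | forall i, 0 <= bar y i (X w)].
  by apply/seteqP; split=> w /=; rewrite triangleP.
apply: measurable_forall => i; apply: measurable_set_bool.
by apply: measurable_fun_ler => //; exact: measurable_bar.
Qed.

Lemma measurable_T_r (y : 'I_3 -> R * R) (r : R) (i : 'I_3)
    (X Y : Omega -> R * R) : signed_area2 y != 0 -> 1 <= r ->
  measurable_fun setT X -> measurable_fun setT Y ->
  measurable [set w | T_r y r i (X w) (Y w)].
Proof.
move=> A0 r1 mX mY; pose s w := r * (1 - bar y i (X w)).
have ms : measurable_fun setT s.
  apply: measurable_funM => //; apply: measurable_funB => //; exact: measurable_bar.
have -> : [set w | T_r y r i (X w) (Y w)] = ~` [set w | bar y i (X w) == 1]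
    `&` [set w | forall j, 0 <= s w * (bar y j (Y w) + (j == i)%:R * (s w - 1))].
  apply/seteqP; split=> w /=; first by move=> /(T_rP _ _ _ _ _ A0 r1)[/negP ? ?].
  by move=> [/negP ? ?]; apply/(T_rP _ _ _ _ _ A0 r1).
apply: measurableI.
  apply: measurableC; apply: measurable_set_bool.
  by apply: measurable_fun_eqr => //; exact: measurable_bar.
apply: measurable_forall => j; apply: measurable_set_bool.
apply: measurable_fun_ler => //; apply: measurable_funM => //.
apply: measurable_funD; first exact: measurable_bar.
by apply: measurable_funM => //; exact: measurable_funB.
Qed.

(** The map v enters only through its finitely many level sets; on each of them
    the region is defined by polynomial inequalities. *)
Lemma measurable_N_PE (y : 'I_3 -> R * R) (v : R * R -> 'I_3) (r : R)
    (X Y : Omega -> R * R) : signed_area2 y != 0 -> 1 <= r ->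
  measurable_fun setT X -> measurable_fun setT Y ->
  (forall k, measurable [set w | v (X w) = k]) ->
  measurable [set w | N_PE y v r (X w) (Y w)].
Proof.
move=> A0 r1 mX mY mv.
pose V := [set w | exists k, X w = y k].
have mV : measurable V.
  by apply: measurable_exists => k; apply: measurable_eq_pt.
have rangeE w : (X w \in range y) = (w \in V).
  by apply/idP/idP; rewrite !inE => -[k]; [move=> _ kX|move=> kX]; exists k.
have -> : [set w | N_PE y v r (X w) (Y w)]
  = (V `&` [set w | Y w = X w])
  `|` (~` V `&` ([set w | triangle y (Y w)] `&`
         [set w | exists k, ([set w | v (X w) = k]
                   `&` [set w | T_r y r k (X w) (Y w)]) w])).
  apply/seteqP; split=> w /=; rewrite /N_PE rangeE.
    case: ifPn; rewrite ?inE; first by left.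
    by rewrite notin_setE => nV [h1 h2]; right; do !split=> //; exists (v (X w)).
  case=> [[Vw ->]|[nV [h1 [k [<- h2]]]]]; first by rewrite ifT ?inE.
  by rewrite ifN ?notin_setE.
apply: measurableU; apply: measurableI => //; first exact: measurable_eq_pt.
  exact: measurableC.
apply: measurableI; first exact: measurable_triangle.
by apply: measurable_exists => k; apply: measurableI => //; exact: measurable_T_r.
Qed.

(** At the level t, {U <= t} contains the disjoint union of {V <= t} and E. *)
Lemma st_lt_pointwise (P : probability Omega R) (U V : Omega -> R)
    (E : set Omega) (t : R) :
  measurable_fun setT U -> measurable_fun setT V -> (forall w, U w <= V w) ->
  measurable E -> (0 < P E)%E -> (forall w, E w -> U w <= t /\ t < V w) ->
  st_lt P U V.
Proof.
move=> mU mV UV mE PE sep.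
have mle (f : Omega -> R) a : measurable_fun setT f -> measurable [set w | f w <= a].
  by move=> mf; apply: measurable_set_bool; exact: measurable_fun_ler.
split=> [a|].
  apply: le_measure; rewrite ?inE; [exact: mle|exact: mle|].
  by move=> w /=; exact: le_trans.
exists t; apply: (@lt_le_trans _ _ (P ([set w | V w <= t] `|` E))).
  rewrite measureU //; [|exact: mle|].
    by rewrite lteDl // fin_num_measure //; exact: mle.
  by apply/seteqP; split=> // w [/= h1 /sep[_]]; rewrite ltNge h1.
apply: le_measure; rewrite ?inE; [|exact: mle|].
  by apply: measurableU => //; exact: mle.
by move=> w [/= h|/sep[]//]; exact: le_trans h.
Qed.

End Measurability.

(** * An event on which the digraph is a transitive tournament *)

Lemma prode_gt0 {R : realType} n (f : 'I_n -> \bar R) :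
  (forall i, 0 < f i)%E -> (0 < \prod_i f i)%E.
Proof.
move=> f0; apply: (big_ind (fun a => 0 < a)%E) => //.
by move=> a b a0 b0; exact: mule_gt0.
Qed.

(** The normalizing constant cannot vanish, since P has total mass 1; this covers
    the positivity and the finiteness of the area of T. *)
Lemma uniform_on_gt0 {R : realType} {d : measure_display}
    {Omega : measurableType d} (P : probability Omega R) (T : set (R * R))
    (X : {RV P >-> (R * R)%type}) (A : set (R * R)) :
  uniform_on T X -> measurable A -> A `<=` T -> (0 < lebesgue2 A)%E ->
  (0 < P (X @^-1` A))%E.
Proof.
move=> unif mA AT lA; have := unif A mA; rewrite (setIidl AT).
rewrite /distribution /pushforward /= => ->.
have c0 : (fine (lebesgue2 T))^-1 != 0.
  apply/eqP => c0; have := unif setT measurableT; rewrite c0 mule0.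
  rewrite /distribution /pushforward /= preimage_setT probability_setT.
  by move/eqP; rewrite onee_eq0.
apply: mule_gt0 => //; rewrite lte_fin lt_neqAle eq_sym c0 /= invr_ge0.
by apply: fine_ge0; exact: measure_ge0.
Qed.

(** Heights of the strip of index i.  Every other interval between powers of 1/M
    is left out, which keeps a gap of ratio M between successive strips; below
    1/2, a point is in the vertex region of y 0. *)
Lemma nested_strips {R : realType} (M : R) (i : nat) : 2 <= M ->
  [/\ 0 < (M ^+ (2 * i + 3))^-1, (M ^+ (2 * i + 3))^-1 < (M ^+ (2 * i + 2))^-1
    & (M ^+ (2 * i + 2))^-1 < 1 / 2].
Proof.
move=> M2; have M0 : 0 < M by lra.
have M1 : 1 < M by lra.
split; first by rewrite invr_gt0 exprn_gt0.
  by rewrite ltf_pV2 ?posrE ?exprn_gt0 // ltr_eXn2l // ltn_add2l.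
rewrite div1r ltf_pV2 ?posrE ?exprn_gt0 //.
apply: (@lt_le_trans _ _ (M ^+ 2)); first by rewrite expr2; nra.
by rewrite ler_eXn2l // leq_addl.
Qed.

Lemma nested_strips_sep {R : realType} (M r : R) (i j : nat) : 2 <= M ->
  0 <= r -> r <= M -> (i < j)%N ->
  r * (M ^+ (2 * j + 2))^-1 <= (M ^+ (2 * i + 3))^-1.
Proof.
move=> M2 r0 rM ij; have M0 : 0 < M by lra.
apply: (@le_trans _ _ (M * (M ^+ (2 * j + 2))^-1)).
  by rewrite ler_wpM2r // invr_ge0 exprn_ge0 // ltW.
have -> : (2 * j + 2 = (2 * j + 1).+1)%N by lia.
rewrite exprS invfM mulVKf ?gt_eqF // lef_pV2 ?posrE ?exprn_gt0 //.
rewrite ler_weXn2l //; first by lra.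
by move: ij; lia.
Qed.

Theorem theorem4p4 (R : realType) (y : 'I_3 -> R * R) (v : R * R -> 'I_3)
    (y_noncollinear : ~ collinear3 y) (v_choice : vertex_choice y v) :
  exists2 r0 : R, 1 < r0 &
  forall r : R, 1 <= r -> r < r0 ->
  exists N : nat, forall n : nat, (N <= n)%N ->
  forall (d : measure_display) (Omega : measurableType d)
    (P : probability Omega R) (X : 'I_n -> {RV P >-> (R * R)%type}),
    mutually_independent X ->
    (forall i, uniform_on (triangle y) (X i)) ->
    (forall i k, measurable [set w | v (X i w) = k]) ->
    let D := fun w => pcd y v r (fun i => X i w) in
    let rho := fun w => rel_arc_density (D w) : R in
    let rho_and := fun w => rel_edge_density (reflexivity_graph (D w)) : R in
    let rho_or := fun w => rel_edge_density (underlying_graph (D w)) : R in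
    st_lt P rho_and rho /\ st_lt P rho rho_or.
Proof.
have A0 := signed_area2_neq0 y y_noncollinear.
exists 2 => [|r r1 r2]; first by lra.
exists 2 => n n2 d Omega P X indep unif mv D rho rho_and rho_or.
have mX i : measurable_fun setT (X i) by exact: measurable_funPT.
have mD i j : measurable_fun setT (fun w => D w i j).
  apply: measurable_and => //; apply: measurable_fun_set_bool.
  under eq_set do rewrite inE.
  exact: measurable_N_PE.
have mrho : measurable_fun setT rho.
  apply: measurable_funM => //.
  by apply: measurable_count => a; exact: mD.
have mand : measurable_fun setT rho_and.
  apply: measurable_funM => //.
  apply: measurable_count => a; apply: measurable_and => //.
  by apply: measurable_and; exact: mD.
have mor : measurable_fun setT rho_or.
  apply: measurable_funM => //.
  apply: measurable_count => a; apply: measurable_and => //.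
  by apply: measurable_or; exact: mD.
have Dii w i : ~~ D w i i by rewrite /D /pcd eqxx.
pose lo i : R := (2 ^+ (2 * i + 3))^-1.
pose hi i : R := (2 ^+ (2 * i + 2))^-1.
have squares (i : 'I_n) : exists A : set (R * R),
    [/\ measurable A, A `<=` strip y (lo i) (hi i) & (0 < lebesgue2 A)%E].
  have [lo0 lohi _] := @nested_strips R 2 i (lexx _).
  exact: (strip_square y _ _ A0 lo0 lohi).
have [A AP] := choice squares.
pose E := [set w | forall i, i \in [set: 'I_n]%SET -> A i (X i w)].
have mA i : measurable (A i) by have [] := AP i.
have mE : measurable E.
  have -> : E = [set w | forall i, A i (X i w)].
    by apply/seteqP; split=> w h i; [exact: h (finset.in_setT i)|move=> _; exact: h].
  apply: measurable_forall => i.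
  by have := mX i measurableT (A i) (mA i); rewrite setTI.
have strip_tri i : strip y (lo i) (hi i) `<=` triangle y.
  move=> x [x1 x2 _ x4]; apply/triangleP => // j.
  have [_ _ hi1] := @nested_strips R 2 i (lexx _).
  by move: x4; rewrite /hi => x4; case: (ord3P j) => ->; lra.
have PE : (0 < P E)%E.
  rewrite indep // big_mkcond; apply: prode_gt0 => i; rewrite finset.in_setT.
  have [_ Ai lA] := AP i.
  by apply: uniform_on_gt0 (unif i) _ _ lA => // x /Ai /strip_tri.
have tournament w : E w -> forall i j, D w i j = (i < j)%N.
  move=> Ew i j; rewrite /D /pcd.
  have S (k : 'I_n) : strip y (lo k) (hi k) (X k w).
    by have [_ Ak _] := AP k; apply: Ak; apply: Ew; rewrite finset.in_setT.
  have [lo0i lohi_i hi1i] := @nested_strips R 2 i (lexx _).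
  have [lo0j lohi_j hi1j] := @nested_strips R 2 j (lexx _).
  rewrite (N_PE_strip _ _ _ _ _ _ _ _ _ A0 v_choice r1 lo0i hi1i lo0j hi1j (S i) (S j)).
  rewrite -/(lo i) in lo0i.
  have r0 : 0 < r by lra.
  have le12 : 1 <= 2 :> R by rewrite ler1n.
  have [[_ _ i3 i4] [_ _ j3 j4]] := (S i, S j).
  have [ij|ji|ij] := ltngtP i j.
  - have := @nested_strips_sep R 2 1 i j (lexx _) ler01 le12 ij.
    rewrite -/(hi j) -/(lo i) mul1r => hilo.
    have -> /= : i != j by rewrite -val_eqE /= neq_ltn ij.
    have : 1 * (1 - bar y 0 (X i w)) <= r * (1 - bar y 0 (X i w)).
      by rewrite ler_wpM2r //; lra.
    lra.
  - have := @nested_strips_sep R 2 r j i (lexx _) (ltW r0) (ltW r2) ji.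
    rewrite -/(hi i) -/(lo j) => hilo.
    apply/negbTE; rewrite negb_and -ltNge; apply/orP; right.
    have : r * (1 - bar y 0 (X i w)) < r * hi i by rewrite ltr_pM2l.
    lra.
  - by rewrite (val_inj ij) eqxx.
split; [apply: (st_lt_pointwise P _ _ E 0) => // w|].
- by have [] := @density_sandwich R _ _ (Dii w).
- move=> /tournament /(@density_tournament R _ _ n2)[and0 arc or0].
  by rewrite /rho_and and0; split=> //; rewrite /rho arc divr_gt0.
(* K is the underlying edge density of the tournament, the same at each point
   of E. *)
pose K : R := rel_edge_density (underlying_graph (fun i j : 'I_n => (i < j)%N)).
apply: (st_lt_pointwise P _ _ E (K / 2)) => // w.
  by have [] := @density_sandwich R _ _ (Dii w).
move=> /tournament DE.
have KE : rho_or w = K.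
  rewrite /rho_or /K; congr rel_edge_density; apply: funext => i; apply: funext => j.
  by rewrite /underlying_graph !DE.
have [_ arc or0] := @density_tournament R _ _ n2 DE.
by move: or0; rewrite /rho arc -/(rho_or w) KE; split=> //; lra.
Qed.
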